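(* Let $G$ be an arbitrary undirected graph with vertex set $V$, let $(s,\alpha)\in\Pi_G$, and let $\pi_G(\theta|s,\alpha)$ be the conjugate prior on $\theta\in\mathbb{R}^J$ with normalising constant $I_G(s,\alpha)$. The prior on $p=(p(i_D,i^*_{D^c}))_{D\in\mathcal{D},\,i_D\in\mathcal{I}_D^*}$ induced from $\pi_G(\theta|s,\alpha)$ by the change of variables between $p$ and $\theta$, that is, the conjugate prior for the parameter $p$ of the multinomial family Markov with respect to $G$, is (at the points where $K\neq0$) $$\pi_G^p(p\,|\,(s,\alpha))=\frac{K^{-1}}{I_G(s,\alpha)}\;p_\emptyset^{\alpha_\emptyset-1}\prod_{D\in\mathcal{D}}\prod_{i_D\in\mathcal{I}_D^*}p(i_D,i^*_{D^c})^{\alpha(i_D,i^*_{D^c})-1},$$ where $$K=1-\frac1{p_\emptyset}\sum_{H\in\mathcal{U}}\sum_{j_H\in\mathcal{I}_H^*}a(j_H)\,p(j_H,i^*_{H^c}),$$ $$\alpha(i_D,i^*_{D^c})=\sum_{F\in\mathcal{D},\,F\supseteq D}\ \sum_{j_F\in\mathcal{I}_F^*,\,(j_F)_D=i_D}(-1)^{|F\setminus D|}s(j_F),\qquad \alpha_\emptyset=\alpha+\sum_{D\in\mathcal{D}}\sum_{i_D\in\mathcal{I}_D^*}(-1)^{|D|}s(i_D).$$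
   Context: $V$ is a finite set of criteria. For each $\gamma\in V$, $\mathcal{I}_\gamma$ is a finite set of levels containing a distinguished level $0$; $\mathcal{I}=\prod_{\gamma\in V}\mathcal{I}_\gamma$ is the set of cells and $i^*=(0,\dots,0)$. For $E\subseteq V$, $i_E=(i_\gamma)_{\gamma\in E}$, $E^c=V\setminus E$, and $(i_E,i^*_{E^c})$ is the cell equal to $i_E$ on $E$ and to $0$ off $E$. For $\emptyset\neq E\subseteq V$, $\mathcal{I}_E^*=\{(i_\gamma)_{\gamma\in E}: i_\gamma\in\mathcal{I}_\gamma,\ i_\gamma\neq0\ \forall\gamma\in E\}$. $\mathcal{D}$ is the set of nonempty complete subsets of $G$; $J=\{(D,i_D): D\in\mathcal{D},\,i_D\in\mathcal{I}_D^*\}$; $\theta=(\theta_D(i_D))\in\mathbb{R}^J$. For $i\in\mathcal{I}$, $\mathcal{D}_i^*=\{D\in\mathcal{D}: i_\gamma\ne0\ \forall\gamma\in D\}$. The cell probabilities of the multinomial model Markov with respect to $G$ are $$p(i)=\frac{\exp\sum_{D\in\mathcal{D}_i^*}\theta_D(i_D)}{1+\sum_{j\ne i^*}\exp\sum_{D\in\mathcal{D}_j^*}\theta_D(j_D)},\qquad p_\emptyset=p(i^* ),$$ so that $\theta_D(i_D)=\sum_{F\subseteq D}(-1)^{|D\setminus F|}\log p(i_F,i^*_{F^c})$. In terms of $p$, the density of the marginal counts $y=(y(i_D))_{(D,i_D)\in J}$ with total count $n$ is proportional to $\exp\{\sum_{(D,i_D)\in J}\theta_D(i_D)y(i_D)\}\,p_\emptyset^{\,n}$.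 The conjugate prior for $\theta$ is $$\pi_G(\theta|s,\alpha)=I_G(s,\alpha)^{-1}\exp\Big\{\sum_{D\in\mathcal{D}}\sum_{i_D\in\mathcal{I}_D^*}\theta_D(i_D)s(i_D)-\alpha\log\Big(1+\sum_{i\neq i^*}\exp\sum_{D\in\mathcal{D}_i^*}\theta_D(i_D)\Big)\Big\},$$ where $I_G(s,\alpha)$ is the integral of the exponential over $\mathbb{R}^J$. $\Pi_G$ is the set of $(s,\alpha)\in\mathbb{R}^J\times\mathbb{R}$ with $\alpha>0$ such that, for some $\theta\in\mathbb{R}^J$ with associated cell probabilities $p(\cdot)$, $s(i_D)/\alpha=\sum_{j\in\mathcal{I},\,j_D=i_D}p(j)$ for all $(D,i_D)\in J$ (equivalently, $I_G(s,\alpha)<\infty$). The prior on $p$ induced by the change of variables means the expression given by the change-of-variables formula, $\pi_G^p(p\,|\,(s,\alpha))=\pi_G(\theta|s,\alpha)\,\big|\frac{dp}{d\theta}\big|^{-1}$, where $p$ corresponds to $\theta$ and $\big|\frac{dp}{d\theta}\big|$ is the determinant of the Jacobian matrix of $\theta\mapsto p$ (coordinates of $\theta$ and $p$ indexed by $J$ in the same order); $p_\emptyset$ and the $p(j_H,i^*_{H^c})$ are the cell probabilities at this same $\theta$. $\mathcal{U}$ is the set of nonempty $H\subseteq V$ whose induced subgraph $G_H$ is either nondecomposable (not chordal) or not connected. For $\emptyset\ne H\subseteq V$, $j_H\in\mathcal{I}_H^*$, $$a(j_H)=\Big(\sum_{C\in\mathcal{D}}\sum_{i_C\in\mathcal{I}_C^*}F(i_C,j_H)\Big)-1,$$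 where $F(i_C,j_H)=(-1)^{|C|-1}$ if $C\subseteq H$ and $(j_H)_C=i_C$, and $F(i_C,j_H)=0$ otherwise. *)

(* Defs.v *)
From HB Require Import structures.
From mathcomp Require Import all_boot all_order all_algebra.
From mathcomp Require Import all_classical all_reals all_analysis.

Set Implicit Arguments.
Unset Strict Implicit.
Unset Printing Implicit Defensive.

Import Order.TTheory GRing.Theory Num.Theory.
Import numFieldNormedType.Exports.

Local Open Scope ring_scope.

(* Lebesgue measure on n-tuples of reals: the n-fold product of the Lebesgue
   measure on the line, with R^(n+1) identified with R * R^n. *)
Section LebesguePower.
Context (R : realType).

Notation Rn n := (n.-tuple (measurableTypeR R)).

Definition tcons n (u : measurableTypeR R * Rn n) : Rn n.+1 :=
  [tuple of u.1 :: u.2].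

Lemma measurable_tcons n : measurable_fun setT (@tcons n).
Proof. exact: measurable_cons. Qed.

Section Step.
Context n (mu : {sigma_finite_measure set (Rn n) -> \bar R}).

Definition lebesgue_step : set (Rn n.+1) -> \bar R :=
  pushforward (lebesgue_measure \x mu)%E (@tcons n).

Let step0 : lebesgue_step set0 = 0%E.
Proof. by rewrite /lebesgue_step /pushforward preimage_set0 measure0. Qed.

Let step_ge0 A : (0 <= lebesgue_step A)%E.
Proof. by apply: measure_ge0; exact: measurable_tcons. Qed.

Let step_sigma_additive : semi_sigma_additive lebesgue_step.
Proof.
apply: (@measure_semi_sigma_additive _ _ _ (pushforward _ _)).
exact: measurable_tcons.
Qed.

HB.instance Definition _ :=
  isMeasure.Build _ _ _ lebesgue_step step0 step_ge0 step_sigma_additive.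

Let step_sigma_finite : sigma_finite setT lebesgue_step.
Proof.
have /sigma_finiteP[F [TF ndF Foo]] := sigma_finiteT (@lebesgue_measure R).
have /sigma_finiteP[G [TG ndG Goo]] := sigma_finiteT mu.
pose u (t : Rn n.+1) := (thead t, [tuple of behead t] : Rn n).
have uK : cancel (@tcons n) u.
  by move=> [x t]; congr (_, _); apply: val_inj.
have mu_ : measurable_fun setT u.
  apply/measurable_fun_pair; [exact: measurable_tnth|exact: measurable_behead].
exists (fun k => u @^-1` (F k `*` G k))%classic.
  rewrite -preimage_bigcup (_ : \bigcup_k _ = setT)%classic ?preimage_setT//.
  rewrite -setXTT TF TG predeqE => -[x y]; split.
    by move=> [k _ []/= ? ?]; split; exists k.
  move=> [/= [k _ Fkx] [l _ Gly]]; exists (maxn k l) => //; split.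
  - by move: x Fkx; exact/subsetPset/ndF/leq_maxl.
  - by move: y Gly; exact/subsetPset/ndG/leq_maxr.
move=> k; have [mFk Fk] := Foo k; have [mGk Gk] := Goo k; split.
  by rewrite -[X in measurable X]setTI; apply: mu_ => //; exact: measurableX.
rewrite /lebesgue_step /pushforward -comp_preimage (_ : u \o _ = id)/=.
  by rewrite preimage_id product_measure1E// lte_mul_pinfty// ge0_fin_numE.
by apply/funext => x; exact: uK.
Qed.

HB.instance Definition _ :=
  Measure_isSigmaFinite.Build _ _ _ lebesgue_step step_sigma_finite.

End Step.

Fixpoint lebesgue_power n : {sigma_finite_measure set (Rn n) -> \bar R} :=
  match n with
  | 0 => \d_([tuple] : Rn 0)
  | n.+1 => lebesgue_step (lebesgue_power n)
  end.

End LebesguePower.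

Section Graph.
Context (V : finType).

Definition complete (e : rel V) (D : {set V}) : bool :=
  [forall x in D, forall y in D, (x != y) ==> e x y].

Definition cliques (e : rel V) : {set {set V}} :=
  [set D : {set V} | (D != finset.set0) && complete e D].

Definition induced (e : rel V) (H : {set V}) : rel V :=
  [rel x y | [&& x \in H, y \in H & e x y]].

Definition chordal (e : rel V) : Prop :=
  forall c : seq V, ucycle e c -> (4 <= size c)%N ->
    exists x y, [/\ x \in c, y \in c, e x y, y != next c x & x != next c y].

Definition connected_on (e : rel V) (H : {set V}) : Prop :=
  {in H &, forall x y, connect (induced e H) x y}.

Definition calU (e : rel V) : {set {set V}} :=
  [set H : {set V} | (H != finset.set0)
    && `[< ~ chordal (induced e H) \/ ~ connected_on e H >]].

End Graph.

Section Model.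
Context (R : realType) (V : finType) (I : V -> finType).
Context (zero : forall g, I g) (e : rel V).

Notation cell := {dffun forall g : V, I g}.

(* A partial cell i_D is represented by the full cell (i_D, i^*_{D^c}), so that
   the restriction i |-> i_D replaces the levels off D by the level 0, and
   (i_D, i^*_{D^c}) needs no notation of its own. *)
Definition restr (D : {set V}) (i : cell) : cell :=
  [ffun g => if g \in D then i g else zero g].

Definition cell0 : cell := [ffun g => zero g].

Definition Istar (D : {set V}) : {set cell} :=
  [set i : cell | [forall g, (i g != zero g) == (g \in D)]].

Definition J : {set {set V} * cell} :=
  [set u : {set V} * cell | (u.1 \in cliques e) && (u.2 \in Istar u.1)].

(* Vectors indexed by J are row vectors, through the enumeration of J. *)
Notation RJ := 'rV[R]_#|J|.

(* The coordinate w_D(i_D) of w; 0 (never used) when (D, i_D) is not in J. *)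
Definition coord (w : RJ) (D : {set V}) (i : cell) : R :=
  if [pick k | enum_val k == (D, i)] is Some k then w ord0 k else 0.

Definition Dstar (i : cell) : {set {set V}} :=
  [set D in cliques e | [forall g in D, i g != zero g]].

Definition lin_theta (theta : RJ) (i : cell) : R :=
  \sum_(D in Dstar i) coord theta D (restr D i).

Definition partition_fun (theta : RJ) : R :=
  1 + \sum_(j | j != cell0) expR (lin_theta theta j).

Definition prob (theta : RJ) (i : cell) : R :=
  expR (lin_theta theta i) / partition_fun theta.

Definition p_empty (theta : RJ) : R := prob theta cell0.

Definition p_of (theta : RJ) : RJ :=
  \row_k prob theta (enum_val k).2.

Definition prior_kernel (s : RJ) (alpha : R) (theta : RJ) : R :=
  expR (\sum_(D in cliques e) \sum_(i in Istar D) coord theta D i * coord s D i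
        - alpha * ln (partition_fun theta)).

Definition I_G (s : RJ) (alpha : R) : R :=
  \int[lebesgue_power R #|J|]_t
    prior_kernel s alpha (\row_k tnth t k).

Definition prior_theta (s : RJ) (alpha : R) (theta : RJ) : R :=
  (I_G s alpha)^-1 * prior_kernel s alpha theta.

Definition Pi_G (s : RJ) (alpha : R) : Prop :=
  0 < alpha /\
  exists theta : RJ, forall D i, D \in cliques e -> i \in Istar D ->
    coord s D i / alpha = \sum_(j | restr D j == i) prob theta j.

(* The induced prior on p, at the point p that corresponds to theta.  The
   Jacobian determinant is signed, and 'J is the transpose of the matrix with
   entries d p_k / d theta_l, which does not affect the determinant. *)
Definition prior_p (s : RJ) (alpha : R) (theta : RJ) : R :=
  prior_theta s alpha theta * (\det ('J p_of theta))^-1.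

Definition Fcoef (C : {set V}) (i : cell) (H : {set V}) (j : cell) : R :=
  if (C \subset H) && (restr C j == i) then (-1) ^+ (#|C| - 1) else 0.

Definition acoef (H : {set V}) (j : cell) : R :=
  (\sum_(C in cliques e) \sum_(i in Istar C) Fcoef C i H j) - 1.

Definition K_of (theta : RJ) : R :=
  1 - (p_empty theta)^-1 *
      \sum_(H in calU e) \sum_(j in Istar H) acoef H j * prob theta j.

Definition alpha_cell (s : RJ) (D : {set V}) (i : cell) : R :=
  \sum_(F in cliques e | D \subset F)
    \sum_(j in Istar F | restr D j == i) (-1) ^+ #|F :\: D| * coord s F j.

Definition alpha_empty (s : RJ) (alpha : R) : R :=
  alpha + \sum_(D in cliques e) \sum_(i in Istar D) (-1) ^+ #|D| * coord s D i.

End Model.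

(* Main.v *)
Require Import Defs.
From HB Require Import structures.
From mathcomp Require Import all_boot all_order all_algebra perm.
From mathcomp Require Import all_classical all_reals all_analysis.
From mathcomp Require Import ring.

Set Implicit Arguments.
Unset Strict Implicit.
Unset Printing Implicit Defensive.

Import Order.TTheory GRing.Theory Num.Theory.
Import numFieldNormedType.Exports.

Local Open Scope ring_scope.

(** Two computations give the formula.

    The kernel.  Write h(E) for theta_E(j_E) when E is nonempty, and h(set0) for
    ln p_empty.  On a cell supported by a clique F, the model says
    ln p(j_D, 0) = \sum_(E \subset D) h(E) for every D \subset F, so Moebius
    inversion on the subsets of F expresses theta_F(j_F) as an alternating sum of
    logarithms of cell probabilities.  Substituting this in the exponent of
    the prior and collecting the coefficient of each ln p turns the kernel into
    p_empty ^ alpha_empty * \prod p ^ alpha_cell ([prior_kernelE]).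

    The Jacobian.  Since d p(i_D) / d theta_E(i_E) is p(i_D) times
    [i_E is the restriction of i_D to E] minus the marginal q(i_E), the matrix is
    diag(p) (M - 1 q), with M the incidence matrix of a partial order on the
    cells of J.  M is unitriangular and sends the vector w = (-1)^(|D|-1) to the
    constant 1 (nonempty subsets of a simplex have alternating sum 1), hence the
    determinant is \prod p times 1 - q w.  Expanding q as a sum over all cells,
    1 - q w = \sum_j p(j) chi(supp j), where chi(H) is the alternating sum over
    all complete subsets of H, the empty one included; up to sign, chi(H) is the
    coefficient a of the theorem, and the cell 0 contributes p_empty.

    It remains to see that only the sets of [calU] contribute, that is, that
    chi(H) = 0 when H is nonempty, connected and chordal: the clique complex of
    such a graph is contractible.  Deleting a vertex v gives
    chi(H) = chi(H - v) - chi(N(v)), with N(v) the neighbourhood of v in H.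
    If v is not a cut vertex, then H - v is connected, and chordality forces
    N(v) to be connected too ([chordal_nbhd_connected]), so both terms vanish by
    induction ([euler_sum_chordal_connected]). *)

Local Notation induced := Defs.induced.
Local Notation complete := Defs.complete.
Local Notation coord := Defs.coord.


(** * Chordal graphs *)

Section ChordalGraphs.
Context (V : finType).
Implicit Types (e : rel V) (H : {set V}) (v x y z : V) (p : seq V).

Lemma next_uniq_cat p z y q :
  uniq (p ++ z :: y :: q) -> next (p ++ z :: y :: q) z = y.
Proof.
by move=> u; rewrite -(next_rot (size p)) // rot_size_cat /= eqxx.
Qed.

Lemma next_uniq_last v p z : uniq (v :: rcons p z) -> next (v :: rcons p z) z = v.
Proof.
move=> u; rewrite -(next_rot (size (v :: p))) //.
by rewrite -cats1 -cat_cons rot_size_cat /= eqxx.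
Qed.

Lemma induced_sym e H : symmetric e -> symmetric (induced e H).
Proof. by move=> es x y; rewrite /induced /= es andbCA. Qed.

Lemma induced_sub e H H' : H' \subset H -> subrel (induced e H') (induced e H).
Proof.
move=> /fintype.subsetP sHH x y /and3P[xH yH exy].
by rewrite /induced /= !sHH.
Qed.

Lemma path_induced_sub e H x p :
  path (induced e H) x p -> {subset p <= H}.
Proof.
elim: p x => [|y p IHp] x //= /andP[/and3P[_ yH _] /IHp sub] z.
by rewrite inE => /predU1P[->|/sub].
Qed.

Lemma chordal_sub e H H' :
  H' \subset H -> chordal (induced e H) -> chordal (induced e H').
Proof.
move=> sHH ch c /andP[cy uc] sz.
have [|x [y [xc yc /and3P[_ _ exy] ny nx]]] := ch c _ sz.
  by rewrite /ucycle uc andbT; apply: sub_cycle cy; exact: induced_sub.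
exists x, y; split=> //; rewrite /induced /= exy andbT.
have mem z : z \in c -> z \in H'.
  by move=> zc; have /and3P[] := next_cycle cy zc.
by rewrite !mem.
Qed.

(** If a path of H - v joins two neighbours of v, then closing it through v gives
    a cycle.  A chord of this cycle either ends at v, and cuts the path at a third
    neighbour of v, or is a shortcut of the path.  Both give shorter paths
    between neighbours, and the recursion stops at a single edge inside N(v). *)
Lemma chordal_nbhd_connected e H v :
    symmetric e -> irreflexive e -> chordal (induced e H) -> v \in H ->
  connected_on e (H :\ v) -> connected_on e [set x in H | e v x].
Proof.
move=> es ei ch vH co; set N := [set x in H | e v x].
have NP x : x \in N -> x \in H :\ v.
  rewrite !inE => /andP[-> evx]; rewrite andbT.
  by apply: contraTneq evx => ->; rewrite ei.
suff main n p x : (size p <= n)%N -> path (induced e (H :\ v)) x p ->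
    x \in N -> last x p \in N -> connect (induced e N) x (last x p).
  move=> x y xN yN; have /connectP[p pth eqy] := co x y (NP _ xN) (NP _ yN).
  by rewrite eqy; apply: main pth xN _ => //; rewrite -eqy.
elim: n p x => [|n IHn] p0 x.
  by rewrite leqn0 size_eq0 => /eqP-> _ _ _; exact: connect0.
move=> szp0; case/shortenP => p pth up subp xN lN.
have {subp szp0} szp : (size p <= n.+1)%N.
  apply: leq_trans szp0; apply: uniq_leq_size subp.
  by case/andP: up.
(* the path may be cut at an interior vertex that is a neighbour of v *)
have split_at w p1 p2 : p = p1 ++ w :: p2 -> p2 != [::] -> w \in N ->
    connect (induced e N) x (last x p).
  move=> pE p2n wN; move: pth lN szp; rewrite pE cat_path /= last_cat /=.
  rewrite size_cat /= addnS ltnS => /and3P[pth1 ew pth2] lN szp.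
  apply: (@connect_trans _ _ w).
    rewrite -[w in connect _ _ w](last_rcons x p1 w); apply: IHn => //.
    - rewrite size_rcons; apply: leq_trans szp.
      by rewrite -addn1 leq_add2l lt0n size_eq0.
    - by rewrite rcons_path pth1.
    - by rewrite last_rcons.
  by apply: IHn => //; apply: leq_trans szp; rewrite leq_addl.
have vp : v \notin x :: p.
  rewrite inE; apply/norP; split.
    by apply: contraTneq xN => <-; rewrite inE ei andbF.
  by apply/negP => /(path_induced_sub pth); rewrite !inE eqxx.
case: (ltnP 1 (size p)) => [sz2|]; last first.
  case: (p) pth lN => [|y [|//]] /=; first by move=> *; exact: connect0.
  move=> /andP[/and3P[_ _ exy] _] yN _; apply: connect1.
  by apply/and3P; split.
pose c := v :: x :: p.
have uc : uniq c by rewrite /c cons_uniq vp up.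
(* an edge between two vertices that are not consecutive on the path *)
have shortcut z w p1 q q2 : p = p1 ++ q ++ w :: q2 -> last x p1 = z ->
    e z w -> w != next c z -> connect (induced e N) x (last x p).
  move=> pE lz ezw nw.
  have qn : q != [::].
    apply: contraNneq nw => q0; move: uc.
    rewrite /c pE q0 cat0s -2!cat_cons (lastI v (x :: p1)) cat_rcons.
    by rewrite [last v _]lz => /next_uniq_cat->.
  have zH : z \in H :\ v.
    have := mem_last x p1; rewrite lz inE => /predU1P[->|]; first exact: NP.
    by move: pth; rewrite pE cat_path => /andP[/path_induced_sub s _] /s.
  move: pth lN szp; rewrite pE !cat_path !last_cat lz /=.
  rewrite !size_cat /= => /and4P[pth1 _ ew pth2] lN szp.
  have -> : last w q2 = last x (p1 ++ w :: q2) by rewrite last_cat.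
  apply: IHn => //; last by rewrite last_cat.
    rewrite size_cat /= -ltnS; apply: leq_trans szp.
    by rewrite -addnS leq_add2l -addn1 addnC leq_add2r lt0n size_eq0.
  rewrite cat_path pth1 lz /= pth2 andbT.
  by apply/and3P; split => //; case/and3P: ew.
have ucH : ucycle (induced e H) c.
  rewrite /ucycle uc andbT /= rcons_path; apply/and3P; split.
  - by apply/and3P; split=> //; move: xN; rewrite inE => /andP[].
  - by apply: sub_path pth; apply: induced_sub; exact: finset.subD1set.
  - move: lN; rewrite inE => /andP[lH lv].
    by apply/and3P; split=> //; rewrite es.
have {ucH} [//|z [w [zc wc /and3P[zH wH ezw] nw nz]]] := ch c ucH.
(* chords with v as an end; both neighbours of v on the cycle are excluded *)
have from_v u : u \in c -> u \in H -> e v u -> u != next c v -> v != next c u ->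
    connect (induced e N) x (last x p).
  have -> : next c v = x by rewrite /= eqxx.
  move=> uc' uH evu ux vu.
  move: uc'; rewrite /c !inE (negPf ux) /=.
  have /negPf-> /= : u != v by apply: contraTneq evu => ->; rewrite ei.
  move=> up'; have [p1 [p2 pE]] : exists p1 p2, p = p1 ++ u :: p2.
    by case/splitPr: up' => p1 p2; exists p1, p2.
  apply: (split_at u p1 p2 pE) => //; last by rewrite inE uH.
  apply: contraNneq vu => p20; move: uc.
  by rewrite /c pE p20 cats1 -rcons_cons => /next_uniq_last->.
have [zv|zv] := eqVneq z v; first by apply: (from_v w) => //; rewrite -zv.
have [wv|wv] := eqVneq w v.
  by apply: (from_v z) => //; rewrite -wv // es.
move: zc wc; rewrite /c !(in_cons v) (negPf zv) (negPf wv) /= => zc wc.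
have splitl u r : u \in x :: r -> exists r1 r2, r = r1 ++ r2 /\ last x r1 = u.
  by case/splitPl => r1 r2; exists r1, r2.
have [p1 [p2 [pE lz]]] := splitl z p zc.
have [wp2|wp2] := boolP (w \in p2).
  have [q1 [q2 p2E]] : exists q1 q2, p2 = q1 ++ w :: q2.
    by case/splitPr: wp2 => q1 q2; exists q1, q2.
  by apply: (shortcut z w p1 q1 q2) => //; rewrite pE p2E.
have wp1 : w \in x :: p1.
  by move: wc; rewrite pE -cat_cons mem_cat (negPf wp2) orbF.
have [r1 [r2 [p1E lw]]] := splitl w p1 wp1.
case/lastP r2E: {1}r2 => [|r2' z'].
  by move: ezw; rewrite -lz p1E r2E cats0 lw ei.
have zz' : z' = z by rewrite -lz p1E r2E last_cat last_rcons.
apply: (shortcut w z r1 r2' p2) => //; last by rewrite es.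
by rewrite pE p1E r2E zz' -catA cat_rcons.
Qed.

(** A maximal proper connected subset A of H misses exactly one vertex: some edge
    of H leaves A, and adding its end to A keeps it connected, so the result
    can only be H itself. *)
Lemma exists_noncut_vertex e H : symmetric e -> (1 < #|H|)%N ->
  connected_on e H -> exists2 v, v \in H & connected_on e (H :\ v).
Proof.
move=> es H1 co.
pose P (A : {set V}) := [&& A \proper H, A != finset.set0 &
  [forall x in A, forall y in A, connect (induced e A) x y]].
have /finset.set0Pn[x0 x0H] : H != finset.set0 by rewrite -card_gt0; exact: ltnW.
have P0 : P [set x0].
  apply/and3P; split.
  - by rewrite finset.properEcard finset.sub1set x0H finset.cards1.
  - by apply/finset.set0Pn; exists x0; rewrite inE.
  - apply/forall_inP => x /finset.set1P->; apply/forall_inP => y /finset.set1P->.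
    exact: connect0.
have [A /maxsetP[/and3P[pA /finset.set0Pn[a aA] cA] maxA] _] := maxset_exists P0.
have [sAH [b bH bA]] := fintype.properP pA.
(* an edge of H leaving A, found on a path from a to b *)
have [z [w [zA wA wH ezw]]] :
    exists z w, [/\ z \in A, w \notin A, w \in H & e z w].
  have /connectP[p] := co a b (fintype.subsetP sAH _ aA) bH.
  elim: p a aA => [|y p IHp] x xA /= => [_ bx|]; first by rewrite bx xA in bA.
  move=> /andP[/and3P[_ yH exy] pth] lb.
  have [yA|yA] := boolP (y \in A); first exact: IHp yA pth lb.
  by exists x, y.
have cA' x y : x \in A -> y \in A -> connect (induced e A) x y.
  by move=> xA yA; move/forall_inP: cA => /(_ x xA) /forall_inP/(_ y yA).
have conn_wz x y : x \in w |: A -> y \in w |: A ->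
    connect (induced e (w |: A)) x y.
  have sub : subrel (connect (induced e A)) (connect (induced e (w |: A))).
    by apply: connect_sub => u t ut; apply: connect1; apply: induced_sub ut;
       exact: finset.subsetU1.
  have tz u : u \in w |: A -> connect (induced e (w |: A)) u z.
    case/finset.setU1P => [->|uA]; last by apply: sub; exact: cA'.
    by apply: connect1; rewrite /induced /= !inE eqxx zA orbT es.
  move=> xA yA; apply: connect_trans (tz x xA) _.
  rewrite (sym_connect_sym (induced_sym _ es)); exact: tz.
have wAH : w |: A \subset H by rewrite finset.subUset finset.sub1set wH.
exists w => //; suff -> : H :\ w = A by move=> x y; exact: cA'.
have HwA : H = w |: A.
  apply/eqP; rewrite finset.eqEsubset wAH andbT; apply: contraT => nsub.
  have Pw : P (w |: A).
    apply/and3P; split.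
    - by rewrite fintype.properE wAH.
    - by apply/finset.set0Pn; exists w; rewrite finset.setU11.
    - by apply/forall_inP => x xA; apply/forall_inP => y yA; exact: conn_wz.
  have := maxA _ Pw (finset.subsetU1 _ _) => E.
  by move: wA; rewrite -E finset.setU11.
by rewrite HwA finset.setU1K.
Qed.

End ChordalGraphs.

(** * Alternating sums over sets and over complete sets *)

Section SubsetSums.
Context (R : pzRingType) (V : finType).
Implicit Types (D E F H : {set V}) (x v : V).

(** Pairing each set that avoids x with the set obtained by adding x is what makes
    all the alternating sums below cancel or recurse. *)
Lemma sum_sets_toggle x (P : pred {set V}) (f : {set V} -> R) :
  \sum_(D | P D) f D = \sum_(D : {set V} | (x \notin D) && P D) f D
                     + \sum_(D : {set V} | (x \notin D) && P (x |: D))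
                         f (x |: D).
Proof.
rewrite (bigID (fun D : {set V} => x \notin D)) /=; congr (_ + _).
  by apply: eq_bigl => D; rewrite andbC.
rewrite (reindex_onto (fun D : {set V} => x |: D)
  (fun D : {set V} => D :\ x)) /=; last first.
  by move=> D /andP[_]; rewrite negbK; exact: finset.setD1K.
apply: eq_bigl => D; rewrite finset.setU11 andbT andbC; congr (_ && _).
by apply/eqP/idP => [<-|/finset.setU1K//]; rewrite finset.setD11.
Qed.

Lemma sum_interval_sign E F : E \subset F ->
  \sum_(D : {set V} | (E \subset D) && (D \subset F)) (-1) ^+ #|F :\: D|
    = (E == F)%:R :> R.
Proof.
move=> sEF; have [->|neq] := eqVneq E F.
  rewrite (big_pred1 F) ?finset.setDv ?finset.cards0 // => D.
  by rewrite andbC -finset.eqEsubset.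
have [x xF xE] : exists2 x, x \in F & x \notin E.
  have /properP[_ //] : E \proper F by rewrite finset.properEneq neq.
rewrite (sum_sets_toggle x) -[X in _ + X]opprK.
apply/eqP; rewrite subr_eq0 -sumrN; apply/eqP; apply: eq_big => D.
  rewrite finset.subUset finset.sub1set xF /=; congr (_ && (_ && _)).
  apply/idP/idP => [/fintype.subset_trans->//|sED]; first exact: finset.subsetU1.
  apply/fintype.subsetP => y yE; have := fintype.subsetP sED y yE.
  by case/finset.setU1P=> [yx|//]; rewrite -yx yE in xE.
case/and3P=> xD sED sDF.
have -> : F :\: D = x |: (F :\: (x |: D)).
  rewrite finset.setDUr; apply/finset.setP => y; rewrite !inE.
  case: (y =P x) => [->|_]; rewrite ?xD ?xF //=.
  by case: (y \in D) => //=; case: (y \in F).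
by rewrite finset.cardsU1 !inE eqxx /= exprS mulN1r.
Qed.

(** After exchanging the sums, the coefficient of each h(E) is the alternating sum
    over the interval from E to F, which vanishes unless E = F. *)
Lemma moebius_inversion (h : {set V} -> R) F :
  \sum_(D : {set V} | D \subset F)
    (-1) ^+ #|F :\: D| * (\sum_(E : {set V} | E \subset D) h E) = h F.
Proof.
under eq_bigr do rewrite mulr_sumr.
rewrite (exchange_big_dep (fun E : {set V} => E \subset F)) /=; last first.
  by move=> D E sDF sED; apply: fintype.subset_trans sDF.
rewrite (bigD1 F) //= [X in _ + X]big1 ?addr0.
  rewrite (big_pred1 F) ?finset.setDv ?finset.cards0 ?mul1r // => D.
  by rewrite -finset.eqEsubset.
move=> E /andP[sEF neq].
under eq_bigl do rewrite andbC.
by rewrite -mulr_suml sum_interval_sign // (negPf neq) mul0r.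
Qed.

Lemma sum_nonempty_subsets_sign F : F != finset.set0 ->
  \sum_(D : {set V} | (D != finset.set0) && (D \subset F)) (-1) ^+ (#|D| - 1)
    = 1 :> R.
Proof.
case/finset.set0Pn=> x xF.
have : \sum_(D : {set V} | D \subset F) (-1) ^+ #|D| = 0 :> R.
  rewrite (sum_sets_toggle x) [X in _ + X](_ : _ = - \sum_(D : {set V}
      | (x \notin D) && (D \subset F)) (-1) ^+ #|D|) ?subrr //.
  rewrite -sumrN; apply: eq_big => D.
    by rewrite finset.subUset finset.sub1set xF.
  by case/andP=> xD _; rewrite finset.cardsU1 xD exprS mulN1r.
rewrite (bigD1 finset.set0) ?finset.sub0set //= finset.cards0 expr0.
move/eqP; rewrite addr_eq0 => /eqP S1; rewrite [RHS]S1 -sumrN.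
apply: eq_big => [D|D /andP[D0 _]]; first by rewrite andbC.
have {}D0 : (0 < #|D|)%N by rewrite finset.card_gt0.
by rewrite -{2}(subnK D0) addn1 exprS mulN1r opprK.
Qed.

Context (e : rel V).

Lemma complete_sub D F : D \subset F -> complete e F -> complete e D.
Proof.
move=> /fintype.subsetP sDF /forall_inP cF; apply/forall_inP => x /sDF xF.
by apply/forall_inP => y /sDF yF; move/forall_inP: (cF x xF); apply.
Qed.

Lemma complete0 : complete e finset.set0.
Proof. by apply/forall_inP => x; rewrite inE. Qed.

Lemma complete_setU1 x D : symmetric e -> x \notin D ->
  complete e (x |: D) = complete e D && [forall y in D, e x y].
Proof.
move=> es xD; apply/idP/andP => [cD|[cD /forall_inP xe]].
  split; first exact: complete_sub (finset.subsetU1 _ _) cD.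
  apply/forall_inP => y yD; move/forall_inP: cD => /(_ x (finset.setU11 _ _)).
  move/forall_inP/(_ y); rewrite inE yD orbT => /(_ isT) /implyP; apply.
  by apply: contraNneq xD => ->.
apply/forall_inP => y yD; apply/forall_inP => z zD; apply/implyP => nyz.
case/finset.setU1P: yD nyz => [->|yD]; case/finset.setU1P: zD => [->|zD].
- by rewrite eqxx.
- by move=> _; exact: xe.
- by move=> _; rewrite es; exact: xe.
- by apply/implyP; move/forall_inP: cD => /(_ y yD) /forall_inP; apply.
Qed.

(** The reduced Euler characteristic, up to sign, of the clique complex of the
    graph induced on H; the empty complete set contributes 1. *)
Definition euler_sum H : R :=
  \sum_(C : {set V} | complete e C && (C \subset H)) (-1) ^+ #|C|.

(** The complete sets containing v are those of its neighbourhood, with v added. *)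
Lemma euler_sum_delete H v : symmetric e -> irreflexive e -> v \in H ->
  euler_sum H = euler_sum (H :\ v) - euler_sum [set x in H | e v x].
Proof.
move=> es ei vH; rewrite /euler_sum (sum_sets_toggle v); congr (_ + _).
  by apply: eq_bigl => C; rewrite finset.subsetD1 andbC -andbA.
rewrite -sumrN; apply: eq_big => C; last first.
  by move=> /andP[vC _]; rewrite finset.cardsU1 vC exprS mulN1r.
rewrite finset.subUset finset.sub1set vH /=.
have -> : (C \subset [set x in H | e v x]) =
    (C \subset H) && [forall y in C, e v y].
  apply/fintype.subsetP/andP => [sC|[/fintype.subsetP sCH /forall_inP ve] y yC].
    by split; [apply/fintype.subsetP|apply/forall_inP] => y /sC;
       rewrite inE => /andP[].
  by rewrite inE sCH ?ve.
have [vC|vC] /= := boolP (v \in C).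
  apply/esym/negbTE/nandP; right; apply/nandP; right.
  by apply/forall_inPn; exists v; rewrite ?ei.
by rewrite complete_setU1 // -andbA [in LHS](andbC [forall _ in _, _]).
Qed.

(** Deletion of a vertex that does not disconnect H leaves two smaller connected
    chordal graphs, H - v and the neighbourhood of v, the latter nonempty because
    H is connected. *)
Lemma euler_sum_chordal_connected H : symmetric e -> irreflexive e ->
  H != finset.set0 -> chordal (induced e H) -> connected_on e H ->
  euler_sum H = 0.
Proof.
move=> es ei; move En : #|H| => n.
elim/ltn_ind: n H En => n IHn H En H0 ch co.
have [H1|H1] := leqP #|H| 1.
  have /finset.cards1P[v ->] : #|H| == 1 by rewrite eqn_leq H1 finset.card_gt0.
  rewrite (@euler_sum_delete _ v) ?inE //; apply/eqP; rewrite subr_eq0.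
  apply/eqP; congr euler_sum; apply/finset.setP => x; rewrite !inE.
  by case: (x =P v) => // ->; rewrite ei.
have [v vH cov] := exists_noncut_vertex es H1 co.
have HvH := finset.subD1set H v.
have ltH : (#|H :\ v| < n)%N.
  by rewrite -En [in ltnRHS](finset.cardsD1 v) vH.
have Hv0 : H :\ v != finset.set0.
  rewrite -finset.card_gt0 -(ltn_add2l 1) addn0.
  by move: H1; rewrite (finset.cardsD1 v) vH.
rewrite (euler_sum_delete es ei vH).
rewrite (IHn _ ltH _ erefl Hv0 (chordal_sub HvH ch) cov) sub0r.
set N := [set x in H | e v x].
have NH : N \subset H by apply/fintype.subsetP => x; rewrite inE => /andP[].
have NHv : N \subset H :\ v by rewrite finset.subsetD1 NH inE ei andbF.
rewrite (IHn #|N|) ?oppr0 //.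
- by apply: leq_ltn_trans ltH; exact: fintype.subset_leq_card.
- have /finset.set0Pn[w wHv] := Hv0.
  have /connectP[[|y p]] := co v w vH (fintype.subsetP HvH _ wHv).
    by move=> _ wv; rewrite wv !inE eqxx in wHv.
  move=> /= /andP[/and3P[_ yH vy] _] _.
  by apply/finset.set0Pn; exists y; rewrite inE yH.
- exact: chordal_sub ch.
- exact: chordal_nbhd_connected.
Qed.

Lemma clique_sum H :
  \sum_(C in cliques e | C \subset H) (-1) ^+ (#|C| - 1) = 1 - euler_sum H.
Proof.
rewrite /euler_sum [X in 1 - X](bigD1 finset.set0) ?complete0
  ?finset.sub0set //=.
rewrite finset.cards0 expr0 opprD addNKr -sumrN; apply: eq_big => C.
  by rewrite inE -andbA andbC.
rewrite inE => /andP[/andP[C0 _] _].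
rewrite -finset.card_gt0 in C0.
by rewrite -{2}(subnK C0) addn1 exprS mulN1r opprK.
Qed.

End SubsetSums.

(** * Triangular matrices and rank-one updates *)

Section Determinants.
Context (R : comPzRingType).

(** A matrix supported on a strict order and the diagonal, the order being given by
    a rank.  A permutation s with nonzero product satisfies r (s k) <= r k for all
    k, with equality only at fixed points; summing over k forces s = 1. *)
Lemma det_ranked_triangular n (M : 'M[R]_n) (r : 'I_n -> nat) :
    (forall k l, M k l != 0 -> k != l -> (r l < r k)%N) ->
  \det M = \prod_k M k k.
Proof.
move=> tri; rewrite /determinant (bigD1 (1%g : {perm 'I_n})) //=.
rewrite odd_perm1 expr0 mul1r.
rewrite [X in _ + X]big1 ?addr0; first by apply: eq_bigr => k _; rewrite perm1.
move=> s s1; have [/forallP nz|] := boolP [forall k, M k (s k) != 0].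
  have le k : (r (s k) <= r k)%N.
    by have [<-//|nk] := eqVneq k (s k); exact: ltnW (tri _ _ (nz k) nk).
  have [k nk] : exists k, k != s k.
    apply/existsP; apply: contraNT s1 => /existsPn fix_s.
    apply/eqP/permP => k; rewrite perm1; apply/esym/eqP.
    by rewrite -[_ == _]negbK.
  have : (\sum_k r (s k) < \sum_k r k)%N.
    rewrite (bigD1 k) //= [ltnRHS](bigD1 k) //= -addSn leq_add ?tri //.
    by apply: leq_sum => l _.
  by rewrite [ltnRHS](reindex_inj (@perm_inj _ s)) ltnn.
rewrite negb_forall => /existsP[k]; rewrite negbK => /eqP Mk0.
by rewrite (bigD1 k) //= Mk0 mul0r mulr0.
Qed.

(** The two block triangular factorizations of one matrix, with opposite Schur
    complements. *)
Lemma det_1_sub_rank1 n (u : 'cV[R]_n) (v : 'rV[R]_n) :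
  \det (1%:M - u *m v) = 1 - (v *m u) 0 0.
Proof.
have E : block_mx (1%:M - u *m v) u 0 1%:M *m block_mx 1%:M 0 v (1%:M : 'M[R]_1)
       = block_mx 1%:M 0 v 1%:M *m block_mx 1%:M u 0 (1%:M - v *m u).
  rewrite !mulmx_block; congr block_mx;
    by rewrite !(mulmx1, mul1mx, mulmx0, mul0mx, addr0, add0r) ?subrK //
      addrC subrK.
move/(congr1 determinant): E.
rewrite !det_mulmx !det_ublock !det_lblock !det1 !mulr1 !mul1r => ->.
by rewrite det_mx11 !mxE.
Qed.

Lemma det_sub_rank1 n (M : 'M[R]_n) (w : 'cV[R]_n) (q : 'rV[R]_n) :
  \det (M - M *m w *m q) = \det M * (1 - (q *m w) 0 0).
Proof.
by rewrite -det_1_sub_rank1 -det_mulmx mulmxBr mulmx1 mulmxA.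
Qed.

End Determinants.

(** * Cells, their supports and their restrictions *)

Section Cells.
Context (V : finType) (I : V -> finType) (zero : forall g, I g) (e : rel V).

Notation cell := {dffun forall g : V, I g}.
Notation restr := (restr zero).
Notation Istar := (Istar zero).
Notation J := (J zero e).
Notation cell0 := (cell0 zero).
Implicit Types (i j : cell) (D E F H : {set V}) (k l : 'I_#|J|).

Definition supp j : {set V} := [set g | j g != zero g].

Lemma in_Istar D j : (j \in Istar D) = (supp j == D).
Proof.
rewrite inE; apply/forallP/eqP => [jD|<- g]; last by rewrite inE.
by apply/finset.setP => g; rewrite inE (eqP (jD g)).
Qed.

Lemma supp_restr D j : supp (restr D j) = D :&: supp j.
Proof.
apply/finset.setP => g; rewrite !inE ffunE.
by case: ifP => //=; rewrite eqxx.
Qed.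

Lemma restr_in_Istar D j : (restr D j \in Istar D) = (D \subset supp j).
Proof. by rewrite in_Istar supp_restr; apply/eqP/finset.setIidPl. Qed.

Lemma in_Dstar D j :
  (D \in Dstar zero e j) = (D \in cliques e) && (D \subset supp j).
Proof.
rewrite [LHS]inE; congr (_ && _).
apply/forall_inP/fintype.subsetP => h g /h; first by rewrite inE.
by rewrite inE.
Qed.

Lemma supp0 : supp cell0 = finset.set0.
Proof. by apply/finset.setP => g; rewrite !inE ffunE eqxx. Qed.

Lemma supp_eq0 j : (supp j == finset.set0) = (j == cell0).
Proof.
apply/eqP/eqP => [j0|->]; last exact: supp0.
apply/ffunP => g; rewrite ffunE; apply/eqP; apply: contraT => jg.
have : g \in supp j by rewrite inE.
by rewrite j0 inE.
Qed.

Lemma restr_restr D E j : E \subset D -> restr E (restr D j) = restr E j.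
Proof.
move=> /fintype.subsetP sED; apply/ffunP => g; rewrite !ffunE.
by case: ifP => // /sED ->.
Qed.

Lemma restr_set0 j : restr finset.set0 j = cell0.
Proof. by apply/ffunP => g; rewrite !ffunE inE. Qed.

Lemma restr_supp j : restr (supp j) j = j.
Proof. by apply/ffunP => g; rewrite ffunE inE; case: eqVneq. Qed.

(** The cell j restricts to the marginal cell indexed by k.  For j itself in the
    family J this is the partial order behind the Jacobian matrix. *)
Definition fits j k : bool := restr (enum_val k).1 j == (enum_val k).2.

Lemma enum_val_J k :
  (enum_val k).1 \in cliques e /\ (enum_val k).2 \in Istar (enum_val k).1.
Proof. by have := enum_valP k; rewrite inE => /andP. Qed.

Lemma big_J (T : Type) (idx : T) (op : Monoid.com_law idx)
    (f : {set V} -> cell -> T) :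
  \big[op/idx]_(k < #|J|) f (enum_val k).1 (enum_val k).2
    = \big[op/idx]_(D in cliques e) \big[op/idx]_(i in Istar D) f D i.
Proof.
rewrite -(big_enum_val (fun u => f u.1 u.2)) /= pair_big_dep /=.
by apply: eq_bigl => u; rewrite inE.
Qed.

Lemma sum_Istar_restr (R : nmodType) D j (f : cell -> R) :
  \sum_(i in Istar D | restr D j == i) f i
    = if D \subset supp j then f (restr D j) else 0.
Proof.
have [sD|sD] := ifPn.
  rewrite (big_pred1 (restr D j)) // => i.
  rewrite andbC /= [RHS]eq_sym; case: eqP => //= <-.
  by rewrite restr_in_Istar.
rewrite big_pred0 // => i; apply: contraNF sD => /andP[iD /eqP ij].
by rewrite -restr_in_Istar ij.
Qed.

(** A marginal cell that j restricts to is determined by its clique, which ranges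
    over the cliques contained in the support of j. *)
Lemma sum_fits (R : nmodType) j (f : {set V} -> cell -> R) :
  \sum_(k | fits j k) f (enum_val k).1 (enum_val k).2
    = \sum_(D in Dstar zero e j) f D (restr D j).
Proof.
rewrite big_mkcond /fits.
rewrite (big_J _ (fun D i => if restr D j == i then f D i else 0)) /=.
rewrite (eq_bigl _ _ (in_Dstar^~ j)) big_mkcondr /=; apply: eq_bigr => D _.
by rewrite -big_mkcondr sum_Istar_restr.
Qed.

Lemma coord_enum (R : realType) (w : 'rV[R]_#|J|) k :
  coord w (enum_val k).1 (enum_val k).2 = w 0 k.
Proof.
rewrite /coord -surjective_pairing; case: pickP => [l /eqP/enum_val_inj->//|].
by move=> /(_ k); rewrite eqxx.
Qed.

End Cells.

(** * Differentials *)

Section Differentials.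
Context (R : realType).

Lemma is_diff_big_sum (U W : normedModType R) (T : Type) (r : seq T)
    (P : pred T) (f df : T -> U -> W) (x : U) :
    (forall i, is_diff x (f i) (df i)) ->
  is_diff x (fun t => \sum_(i <- r | P i) f i t)
            (fun h => \sum_(i <- r | P i) df i h).
Proof.
move=> fdf; elim: r => [|i r IHr].
  rewrite [X in is_diff _ X _](_ : _ = cst 0); last first.
    by apply/funext => t; rewrite big_nil.
  by apply: is_diff_eq; apply/funext => h; rewrite big_nil.
rewrite [X in is_diff _ X _](_ : _ = (if P i then f i else cst 0) +
  (fun t => \sum_(i <- r | P i) f i t)); last first.
  apply/funext => t; rewrite big_cons fctE.
  by case: ifP => // _; rewrite add0r.
have ? : is_diff x (if P i then f i else cst 0) (if P i then df i else 0).
  by case: ifP => _; [exact: fdf|exact: is_diff_cst].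
apply: is_diff_eq; apply/funext => h; rewrite big_cons fctE.
by case: ifP => // _; rewrite add0r.
Qed.

Lemma is_diff_entry n (x : 'rV[R]_n) k :
  is_diff x (fun t : 'rV[R]_n => t 0 k : R^o) (fun h => h 0 k).
Proof.
have lin : linear (fun t : 'rV[R]_n => t 0 k : R^o) by move=> a t h; rewrite !mxE.
pose lM := GRing.isLinear.Build _ _ _ _ _ lin.
pose L : {linear 'rV[R]_n -> R^o} := HB.pack (fun t : 'rV[R]_n => t 0 k : R^o) lM.
apply: DiffDef; first exact: differentiable_coord.
exact: (@diff_lin _ _ _ L x (@coord_continuous _ _ _ _ _)).
Qed.

Lemma is_diff_expR (U : normedModType R) (f df : U -> R) (x : U) :
  is_diff x f df -> is_diff x (fun t => expR (f t)) (fun h => expR (f x) * df h).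
Proof.
move=> fdf; have dE : differentiable (@expR R) (f x).
  by apply/derivable1_diffP; exact: derivable_expR.
have ? : is_diff (f x) (@expR R) (fun h => expR (f x) * h).
  apply: DiffDef => //; apply/funext => h.
  rewrite -[h in LHS]mulr1 [LHS]linearZ /= -deriveE // derive_val mulrC.
  by [].
exact: is_diff_comp.
Qed.

Lemma is_diff_divr (U : normedModType R) (f g df dg : U -> R) (x : U) :
    g x != 0 -> is_diff x f df -> is_diff x g dg ->
  is_diff x (fun t => f t / g t) (fun h => (df h - f x / g x * dg h) / g x).
Proof.
move=> gx0 fdf gdg.
have ? : is_diff x (fun t => (g t)^-1) (fun h => - (g x) ^- 2 * dg h).
  by apply: DiffDef; [exact: differentiableV|rewrite diffV // diff_val].
rewrite [X in is_diff _ X _](_ : _ = f * (fun t => (g t)^-1)) //.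
apply: is_diff_eq; apply/funext => h; rewrite !fctE.
rewrite /GRing.scale /=.
field.
by [].
Qed.

End Differentials.

(** * Cell probabilities *)

Section CellProbabilities.
Context (R : realType) (V : finType) (I : V -> finType).
Context (zero : forall g, I g) (e : rel V).

Notation cell := {dffun forall g : V, I g}.
Notation J := (J zero e).
Notation cell0 := (cell0 zero).
Notation fits := (@fits _ _ zero e).
Implicit Types (i j : cell) (k l : 'I_#|J|).
Implicit Types (t h theta : 'rV[R]_#|J|).

Lemma lin_thetaE t j : lin_theta t j = \sum_(k | fits j k) t 0 k.
Proof.
rewrite /lin_theta -(sum_fits _ _ _ (fun D i => coord t D i)).
by apply: eq_bigr => k _; rewrite coord_enum.
Qed.

Lemma lin_theta_cell0 t : lin_theta t cell0 = 0.
Proof.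
rewrite /lin_theta big_pred0 // => D; rewrite in_Dstar supp0 inE finset.subset0.
by case: eqP => _; rewrite ?andbF.
Qed.

Lemma partition_funE t : partition_fun t = \sum_j expR (lin_theta t j).
Proof.
by rewrite /partition_fun [RHS](bigD1 cell0) //= lin_theta_cell0 expR0.
Qed.

Lemma partition_fun_gt0 t : 0 < partition_fun t.
Proof.
rewrite /partition_fun ltr_wpDr ?ltr01 //.
by apply: sumr_ge0 => j _; exact: expR_ge0.
Qed.

Lemma prob_gt0 t j : 0 < prob t j.
Proof. by rewrite divr_gt0 ?expR_gt0 ?partition_fun_gt0. Qed.

Lemma sum_prob t : \sum_j prob t j = 1.
Proof.
by rewrite -mulr_suml -partition_funE divff // gt_eqF ?partition_fun_gt0.
Qed.

Lemma ln_prob t j : ln (prob t j) = lin_theta t j - ln (partition_fun t).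
Proof.
by rewrite ln_div ?posrE ?expR_gt0 ?partition_fun_gt0 // expRK.
Qed.

End CellProbabilities.

(** * The Jacobian of the cell probabilities *)

Section RowJacobian.
Context (R : realType) (n m : nat).

Lemma is_diff_row (f df : 'I_m -> 'rV[R]_n -> R) (x : 'rV[R]_n) :
    (forall k, is_diff x (f k) (df k)) ->
  is_diff x (fun t => \row_k f k t) (fun h => \row_k df k h).
Proof.
move=> fdf.
have fd k : is_diff x (fun t => f k t *: delta_mx 0 k : 'rV[R]_m)
                      (fun h => df k h *: delta_mx 0 k).
  exact: (@is_diff_comp _ _ _ _ (f k) (df k) (fun a => a *: delta_mx 0 k)
    (fun a => a *: delta_mx 0 k)).
have E (g : 'I_m -> 'rV[R]_n -> R) :
    (fun t => \row_k g k t) = (fun t => \sum_k g k t *: delta_mx 0 k : 'rV[R]_m).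
  apply/funext => t; rewrite [LHS]row_sum_delta.
  by apply: eq_bigr => k _; rewrite mxE.
rewrite 2!E; exact: is_diff_big_sum.
Qed.

Lemma jacobian_row (f df : 'I_m -> 'rV[R]_n -> R) (x : 'rV[R]_n) :
    (forall k, is_diff x (f k) (df k)) ->
  'J (fun t => \row_k f k t) x = \matrix_(l, k) df k (delta_mx 0 l).
Proof.
move=> fdf; apply/matrixP => l k; rewrite /jacobian !mxE.
have ? := is_diff_row fdf.
by rewrite diff_val mxE.
Qed.

End RowJacobian.

Section JacobianOfCells.
Context (R : realType) (V : finType) (I : V -> finType).
Context (zero : forall g, I g) (e : rel V).

Notation cell := {dffun forall g : V, I g}.
Notation restr := (restr zero).
Notation Istar := (Istar zero).
Notation J := (J zero e).
Notation cell0 := (cell0 zero).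
Notation supp := (supp zero).
Notation fits := (@fits _ _ zero e).
Implicit Types (i j : cell) (D E F H : {set V}) (k l : 'I_#|J|).
Implicit Types (t h theta : 'rV[R]_#|J|).

Lemma lin_theta_is_diff theta j : is_diff theta
  (fun t => lin_theta t j) (fun h => lin_theta h j).
Proof.
have E : (fun t => lin_theta t j) = (fun t => \sum_(k | fits j k) (t 0 k : R^o)).
  by apply/funext => t; exact: lin_thetaE.
by rewrite E; apply: is_diff_big_sum => k; exact: is_diff_entry.
Qed.

(** The logarithmic derivative of a cell probability is its linear form minus the
    expectation of this form. *)
Lemma prob_is_diff theta j : is_diff theta (fun t => prob t j)
  (fun h => prob theta j *
              (lin_theta h j - \sum_i prob theta i * lin_theta h i)).
Proof.
have dexp i : is_diff theta (fun t => expR (lin_theta t i))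
    (fun h => expR (lin_theta theta i) * lin_theta h i).
  exact/is_diff_expR/lin_theta_is_diff.
have dZ : is_diff theta (fun t => partition_fun t : R^o)
    (fun h => \sum_i expR (lin_theta theta i) * lin_theta h i).
  have -> : (fun t => partition_fun t : R^o) =
            (fun t => \sum_i expR (lin_theta t i)).
    by apply/funext => t; exact: partition_funE.
  exact: is_diff_big_sum.
have Z0 : partition_fun theta != 0 by rewrite gt_eqF ?partition_fun_gt0.
have /= := is_diff_divr Z0 (dexp j) dZ.
rewrite [X in is_diff _ _ X -> _](_ : _ = (fun h => prob theta j *
   (lin_theta h j - \sum_i prob theta i * lin_theta h i))) //.
apply/funext => h; rewrite /prob.
under [in RHS]eq_bigr => i _ do rewrite mulrAC.
rewrite -mulr_suml; field.
by [].
Qed.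

Definition incidence : 'M[R]_#|J| :=
  \matrix_(k, l) (fits (enum_val k).2 l)%:R.

Definition marginals theta : 'rV[R]_#|J| :=
  \row_l \sum_(j | fits j l) prob theta j.

Definition alt_sign : 'cV[R]_#|J| :=
  \col_(l < #|J|) (-1) ^+ (#|(enum_val l).1| - 1).

(** Transposed because the derivative acts on row vectors from the right. *)
Lemma jacobian_p_of theta :
  ('J (@p_of R V I zero e) theta)^T
    = diag_mx (p_of theta) *m (incidence - const_mx 1 *m marginals theta).
Proof.
rewrite /p_of (jacobian_row (fun k => prob_is_diff theta (enum_val k).2)).
have linD l j : lin_theta (delta_mx 0 l : 'rV[R]_#|J|) j = (fits j l)%:R.
  rewrite lin_thetaE; under eq_bigr do rewrite mxE eqxx /=.
  by rewrite big_mkcond (bigD1 l) //= eqxx big1 ?addr0 => [|k /negPf->];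
     case: ifP.
apply/matrixP => k l; rewrite mul_diag_mx !mxE linD; congr (_ * (_ - _)).
rewrite big_ord1 !mxE mul1r [RHS]big_mkcond; apply: eq_bigr => j _.
by rewrite linD; case: ifP => _; rewrite ?mulr1 ?mulr0.
Qed.

Lemma supp_enum k : supp (enum_val k).2 = (enum_val k).1.
Proof. by have [_] := enum_val_J k; rewrite in_Istar => /eqP. Qed.

(** Ranked by the cardinality of the clique: a cell that k restricts to lives on a
    subset of the clique of k, and equals k when it has the same clique. *)
Lemma det_incidence : \det incidence = 1.
Proof.
rewrite (@det_ranked_triangular _ _ _ (fun k : 'I_#|J| => #|(enum_val k).1|)).
  rewrite big1 // => k _; rewrite mxE /fits.
  by rewrite -{1}supp_enum restr_supp eqxx.
move=> k l; rewrite mxE /fits; case: (restr _ _ =P _) => [fkl _ kl|_];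
  last by rewrite mulr0n eqxx.
have sub : (enum_val l).1 \subset (enum_val k).1.
  have [_] := enum_val_J l; rewrite -{1}fkl restr_in_Istar.
  by rewrite supp_enum.
apply: fintype.proper_card; rewrite finset.properEneq sub andbT.
apply: contra kl => /eqP Elk; apply/eqP/enum_val_inj.
rewrite [LHS]surjective_pairing [RHS]surjective_pairing -fkl Elk.
by rewrite -supp_enum restr_supp.
Qed.

(** This is the alternating sum over the nonempty faces of the simplex that the
    clique of k spans. *)
Lemma incidence_alt_sign : incidence *m alt_sign = const_mx 1.
Proof.
apply/colP => k; rewrite !mxE.
under eq_bigr do rewrite !mxE mulr_natl mulrb.
rewrite -big_mkcond (sum_fits _ _ _ (fun D _ => (-1) ^+ (#|D| - 1))) /=.
have [kJ _] := enum_val_J k; move: kJ; rewrite inE => /andP[k0 ck].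
rewrite -[RHS](sum_nonempty_subsets_sign R k0); apply: eq_bigl => D.
rewrite in_Dstar supp_enum inE.
by case: (boolP (D \subset _)) => [/complete_sub->//|]; rewrite ?andbF ?andbT.
Qed.

(** Each marginal is a sum over cells j, and j contributes to the marginals of the
    cliques in its support; the constant 1 is distributed as the total mass. *)
Lemma marginals_alt_sign theta : 1 - (marginals theta *m alt_sign) 0 0
  = \sum_j prob theta j * euler_sum R e (supp j).
Proof.
rewrite mxE; under eq_bigr do rewrite !mxE mulr_suml.
rewrite (exchange_big_dep predT) //=.
rewrite -[X in X - _](sum_prob theta) -sumrB; apply: eq_bigr => j _.
rewrite -mulr_sumr (sum_fits _ _ _ (fun D _ => (-1) ^+ (#|D| - 1))) /=.
rewrite (eq_bigl _ _ (fun D => in_Dstar _ _ D j)) clique_sum.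
by rewrite mulrBr mulr1 opprB addrC subrK.
Qed.

Lemma acoefE H j : j \in Istar H ->
  acoef R zero e H j = - euler_sum R e H.
Proof.
rewrite in_Istar => /eqP jH; rewrite /acoef.
have -> : \sum_(C in cliques e) \sum_(i in Istar C) Fcoef R zero C i H j =
          \sum_(C in cliques e | C \subset H) (-1) ^+ (#|C| - 1).
  rewrite [RHS]big_mkcondr; apply: eq_bigr => C _; rewrite /Fcoef.
  have [CH|CH] := ifP; last by rewrite big1.
  by rewrite -big_mkcondr sum_Istar_restr jH CH.
by rewrite clique_sum addrAC subrr sub0r.
Qed.

Lemma euler_sum0 : euler_sum R e finset.set0 = 1.
Proof.
rewrite /euler_sum (big_pred1 finset.set0) ?finset.cards0 // => C.
by rewrite finset.subset0 andbC /=; case: eqP => // ->; rewrite complete0.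
Qed.

(** Cells are grouped by support.  The empty support gives p_empty, and the
    supports outside [calU] contribute nothing because they induce connected
    chordal graphs. *)
Lemma p_empty_K theta : symmetric e -> irreflexive e ->
  p_empty theta * K_of theta = \sum_j prob theta j * euler_sum R e (supp j).
Proof.
move=> es ei; have p0 : p_empty theta != 0 by rewrite gt_eqF ?prob_gt0.
(* K carries a factor 1 / p_empty on its sum *)
have expand (p x : R) : p != 0 -> p * (1 - p^-1 * x) = p - x.
  by move=> ?; rewrite mulrBr mulr1 mulVKf.
transitivity (p_empty theta -
    \sum_(H in calU e) \sum_(j in Istar H) acoef R zero e H j * prob theta j).
  exact: expand.
rewrite [RHS](partition_big supp predT) //= [RHS](bigD1 finset.set0) //=.
rewrite [X in _ = X + _](big_pred1 cell0) => [|j]; last by rewrite /= supp_eq0.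
apply: (congr2 +%R); first by rewrite supp0 euler_sum0 mulr1.
rewrite -sumrN [RHS](bigID (mem (calU e))) /= [X in _ = _ + X]big1 ?addr0.
  apply: eq_big => H; first by rewrite !inE andbA andbb.
  move=> _; rewrite -sumrN; apply: eq_big => j; first by rewrite in_Istar.
  move=> jH; rewrite acoefE // mulNr opprK mulrC.
  by move: jH; rewrite in_Istar => /eqP->.
move=> H /andP[H0 HU]; apply: big1 => j /eqP->.
move: HU; rewrite inE H0 /= => /asboolPn/not_orP[/contrapT ch /contrapT co].
by rewrite euler_sum_chordal_connected ?mulr0.
Qed.

Theorem det_jacobian theta : symmetric e -> irreflexive e ->
  \det ('J (@p_of R V I zero e) theta)
    = p_empty theta * K_of theta * \prod_k p_of theta 0 k.
Proof.
move=> es ei; rewrite -det_tr jacobian_p_of det_mulmx det_diag mulrC.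
rewrite -incidence_alt_sign det_sub_rank1 det_incidence mul1r.
apply: (congr1 ( *%R^~ _)); rewrite marginals_alt_sign.
exact/esym/p_empty_K.
Qed.

End JacobianOfCells.

(** * The exponent of the prior, and the theorem *)

Section PriorExponents.
Context (R : realType) (V : finType) (I : V -> finType).
Context (zero : forall g, I g) (e : rel V).

Notation cell := {dffun forall g : V, I g}.
Notation restr := (restr zero).
Notation Istar := (Istar zero).
Notation J := (J zero e).
Notation supp := (supp zero).
Implicit Types (i j : cell) (D E F H : {set V}) (k l : 'I_#|J|).
Implicit Types (t h theta s : 'rV[R]_#|J|).

Lemma cliques_sub D F : D \subset F -> F \in cliques e ->
  (D \in cliques e) = (D != finset.set0).
Proof.
by move=> sDF; rewrite !inE => /andP[_ /(complete_sub sDF)->]; rewrite andbT.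
Qed.

(** On a cell supported by a clique F, ln p(j_D, 0) is the sum over all subsets of
    D of a function h, whose value at the empty set is ln p_empty, the opposite
    of the logarithm of the partition function. *)
Lemma coord_theta_moebius theta F j : F \in cliques e -> j \in Istar F ->
  \sum_(D : {set V} | D \subset F)
    (-1) ^+ #|F :\: D| * ln (prob theta (restr D j)) = coord theta F j.
Proof.
move=> Fc jF; have jFE : supp j = F by apply/eqP; rewrite -in_Istar.
pose h E := if E == finset.set0 then - ln (partition_fun theta)
            else coord theta E (restr E j).
have F0 : F != finset.set0 by move: Fc; rewrite inE => /andP[].
have -> : coord theta F j = h F by rewrite /h (negPf F0) -{3}jFE restr_supp.
rewrite -[RHS]moebius_inversion; apply: eq_bigr => D sDF; congr (_ * _).
rewrite ln_prob (bigD1 finset.set0) ?finset.sub0set //= addrC.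
rewrite [h finset.set0]/h eqxx; congr (_ + _).
rewrite /lin_theta; apply: eq_big => E.
  rewrite in_Dstar supp_restr jFE (finset.setIidPl sDF).
  have [sED|] := boolP (E \subset D); rewrite ?andbF //= andbT.
  by rewrite (cliques_sub (fintype.subset_trans sED sDF)).
rewrite in_Dstar supp_restr finset.subsetI /h inE => /andP[/andP[/negPf-> _]].
by move=> /andP[sED _]; rewrite restr_restr.
Qed.

(** Summation by parts: the Moebius transform in the definition of [alpha_cell] is
    moved from the hyperparameters to g. *)
Lemma sum_alpha_cell s (g : cell -> R) :
  \sum_(D in cliques e) \sum_(i in Istar D) alpha_cell s D i * g i
  = \sum_(F in cliques e) \sum_(j in Istar F) coord s F j *
      \sum_(D in cliques e | D \subset F) (-1) ^+ #|F :\: D| * g (restr D j).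
Proof.
pose c F D : R := (-1) ^+ #|F :\: D|.
transitivity (\sum_(D in cliques e) \sum_(F in cliques e | D \subset F)
    \sum_(j in Istar F) coord s F j * (c F D * g (restr D j))).
  apply: eq_bigr => D _; rewrite /alpha_cell.
  under eq_bigr do rewrite mulr_suml.
  rewrite exchange_big /=; apply: eq_bigr => F /andP[_ sDF].
  under eq_bigr do rewrite mulr_suml.
  rewrite (exchange_big_dep (mem (Istar F))) /=; last by move=> ? ? _ /andP[].
  apply: eq_bigr => j jF.
  have jFE : supp j = F by apply/eqP; rewrite -in_Istar.
  under eq_bigl do rewrite jF /=.
  rewrite (sum_Istar_restr _ _ _ (fun i => c F D * coord s F j * g i)).
  by rewrite jFE sDF -mulrA mulrCA.
rewrite (exchange_big_dep (mem (cliques e))) /=; last by move=> ? ? _ /andP[].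
apply: eq_bigr => F Fc; rewrite exchange_big /=; apply: eq_bigr => j _.
by rewrite mulr_sumr; apply: eq_bigl => D; rewrite Fc.
Qed.

(** [alpha_empty] supplies exactly the terms indexed by D = set0 that complete the
    sums over cliques to Moebius inversion over all subsets. *)
Lemma prior_exponent s theta (alpha : R) :
  \sum_(D in cliques e) \sum_(i in Istar D) coord theta D i * coord s D i
    - alpha * ln (partition_fun theta)
  = alpha_empty s alpha * ln (p_empty theta)
    + \sum_(D in cliques e) \sum_(i in Istar D)
        alpha_cell s D i * ln (prob theta i).
Proof.
have lnp0 : ln (p_empty theta) = - ln (partition_fun theta).
  by rewrite /p_empty ln_prob lin_theta_cell0 sub0r.
rewrite -mulrN -lnp0 /alpha_empty mulrDl addrC -addrA; congr (_ + _).
rewrite sum_alpha_cell mulr_suml -big_split /=; apply: eq_bigr => F Fc.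
rewrite mulr_suml -big_split /=; apply: eq_bigr => j jF.
rewrite -(coord_theta_moebius theta Fc jF) mulrC.
rewrite (bigD1 finset.set0) ?finset.sub0set //= finset.setD0 restr_set0.
rewrite mulrDr mulrCA mulrA; congr (_ + _ * _).
apply: eq_bigl => D; have [sDF|] := boolP (D \subset F); rewrite ?andbF //=.
by rewrite (cliques_sub sDF Fc) andbT.
Qed.

Lemma prior_kernelE s theta (alpha : R) :
  prior_kernel s alpha theta =
    expR (alpha_empty s alpha * ln (p_empty theta)) *
    \prod_(D in cliques e) \prod_(i in Istar D)
       expR (alpha_cell s D i * ln (prob theta i)).
Proof.
rewrite /prior_kernel prior_exponent expRD expR_sum.
by under eq_bigr do rewrite expR_sum.
Qed.

Lemma prod_p_of theta : \prod_k p_of theta 0 k =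
  \prod_(D in cliques e) \prod_(i in Istar D) prob theta i.
Proof.
by under eq_bigr do rewrite mxE; exact: (big_J _ _ _ (fun _ i => prob theta i)).
Qed.

End PriorExponents.

Lemma powR_sub1 (R : realType) (x a : R) : 0 < x ->
  x `^ (a - 1) = expR (a * ln x) / x.
Proof.
by move=> x0; rewrite /powR gt_eqF // mulrBl mul1r expRD expRN lnK.
Qed.

Theorem theorem4p1 (R : realType) (V : finType) (I : V -> finType)
    (zero : forall g : V, I g) (e : rel V)
    (e_sym : symmetric e) (e_irr : irreflexive e)
    (s : 'rV[R]_#|J zero e|) (alpha : R) (hs : Pi_G s alpha)
    (theta : 'rV[R]_#|J zero e|) (hK : K_of theta != 0) :
  prior_p s alpha theta =
    (K_of theta)^-1 / I_G s alpha
    * p_empty theta `^ (alpha_empty s alpha - 1)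
    * \prod_(D in cliques e) \prod_(i in Istar zero D)
        prob theta i `^ (alpha_cell s D i - 1).
Proof.
rewrite /prior_p /prior_theta prior_kernelE det_jacobian // prod_p_of.
under [X in _ = _ * X]eq_bigr => D _.
  under eq_bigr => i _ do rewrite powR_sub1 ?prob_gt0 //.
  rewrite big_split /= prodfV.
  over.
rewrite big_split /= prodfV powR_sub1 ?prob_gt0 // !invfM.
ring.
Qed.
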